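(* Let $\theta \ge \omega_2$ be a regular cardinal, and let $N$ be an elementary substructure of $H(\theta)$ such that $\omega_1 \subseteq N$. If $N$ is guessing, then $N$ is internally unbounded.
   Context: For a set $M$, a set $x \subseteq M$ is bounded in $M$ if there exists $Y \in M$ with $x \subseteq Y$. A set $N$ is guessing if for every set $x \subseteq N$ which is bounded in $N$ and such that $x \cap a \in N$ for all $a \in N \cap [N]^\omega$, there exists $E \in N$ with $x = N \cap E$. A set $N$ is internally unbounded if for every countable set $x \subseteq N$ which is bounded in $N$, there exists $y \in N \cap [N]^\omega$ with $x \subseteq y$. *)

(* Defs.v *)
(* Stdlib, with classical logic and choice. *)
From Stdlib Require Import Classical ClassicalEpsilon FunctionalExtensionality
  PropExtensionality ProofIrrelevance.

(** * The universe of sets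

    Aczel's well-founded trees modulo bisimilarity.  With classical logic and
    choice in the metatheory this is a model of ZFC with standard
    natural numbers, in which replacement holds for arbitrary Rocq functions. *)

Inductive tree : Type := node (A : Type) (f : A -> tree).

Fixpoint bisim (s t : tree) : Prop :=
  match s, t with
  | node A f, node B g =>
      (forall a, exists b, bisim (f a) (g b)) /\
      (forall b, exists a, bisim (f a) (g b))
  end.

Lemma bisim_refl t : bisim t t.
Proof. induction t as [A f IH]; split; intro a; exists a; apply IH. Qed.

Lemma bisim_sym s t : bisim s t -> bisim t s.
Proof.
revert t; induction s as [A f IH]; intros [B g] [H1 H2]; split.
- intro b; destruct (H2 b) as [a Ha]; exists a; auto.
- intro a; destruct (H1 a) as [b Hb]; exists b; auto.
Qed.

Lemma bisim_trans r s t : bisim r s -> bisim s t -> bisim r t.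
Proof.
revert s t; induction r as [A f IH]; intros [B g] [C h] [H1 H2] [K1 K2]; split.
- intro a; destruct (H1 a) as [b Hb]; destruct (K1 b) as [c Hc].
  exists c; eapply IH; eauto.
- intro c; destruct (K2 c) as [b Hb]; destruct (H2 b) as [a Ha].
  exists a; eapply IH; eauto.
Qed.

(* A set is a bisimilarity class of trees. *)
Definition V : Type := {c : tree -> Prop | exists t, c = bisim t}.

Definition cls (t : tree) : V := exist _ (bisim t) (ex_intro _ t eq_refl).

Definition repr (x : V) : tree :=
  proj1_sig (constructive_indefinite_description _ (proj2_sig x)).

Lemma cls_eq s t : cls s = cls t <-> bisim s t.
Proof.
split.
- intro H; apply (f_equal (@proj1_sig _ _)) in H; simpl in H.
  rewrite H; apply bisim_refl.
- intro H; apply eq_sig_hprop; [intros; apply proof_irrelevance|]; simpl.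
  apply functional_extensionality; intro u; apply propositional_extensionality.
  split; intro K; eapply bisim_trans; eauto using bisim_sym.
Qed.

Lemma reprK x : cls (repr x) = x.
Proof.
apply eq_sig_hprop; [intros; apply proof_irrelevance|]; simpl.
unfold repr; destruct constructive_indefinite_description as [t Ht]; auto.
Qed.

Definition tindex (t : tree) : Type := match t with node A _ => A end.
Definition tchild (t : tree) : tindex t -> tree :=
  match t with node _ f => f end.

Definition index (x : V) : Type := tindex (repr x).
Definition elt (x : V) (i : index x) : V := cls (tchild (repr x) i).

Definition mem (z x : V) : Prop := exists i : index x, elt x i = z.

(* The set {f a | a : A}. *)
Definition family {A : Type} (f : A -> V) : V :=
  cls (node A (fun a => repr (f a))).

Declare Scope set_scope.
Delimit Scope set_scope with set.
Bind Scope set_scope with V.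
Open Scope set_scope.

Notation "x ∈ y" := (mem x y) (at level 70, no associativity) : set_scope.

Definition subset (x y : V) : Prop := forall z, z ∈ x -> z ∈ y.
Notation "x ⊆ y" := (subset x y) (at level 70, no associativity) : set_scope.

Lemma mem_cls z t : z ∈ cls t <-> exists i, cls (tchild t i) = z.
Proof.
unfold mem, index, elt; pose proof (proj1 (cls_eq _ _) (reprK (cls t))) as H.
destruct (repr (cls t)) as [A f], t as [B g]; simpl in *; destruct H as [H1 H2].
split; intros [i <-].
- destruct (H1 i) as [j Hj]; exists j; apply cls_eq, bisim_sym, Hj.
- destruct (H2 i) as [j Hj]; exists j; apply cls_eq, Hj.
Qed.

Lemma mem_family A (f : A -> V) z : z ∈ family f <-> exists a, f a = z.
Proof.
unfold family; rewrite mem_cls; simpl.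
split; intros [a Ha]; exists a; rewrite reprK in *; exact Ha.
Qed.

Lemma extensionality x y : (forall z, z ∈ x <-> z ∈ y) -> x = y.
Proof.
intro H; rewrite <- (reprK x), <- (reprK y) in *; apply cls_eq.
destruct (repr x) as [A f], (repr y) as [B g]; split.
- intro a; destruct (proj1 (mem_cls (cls (f a)) (node B g))) as [b Hb].
  + apply H, mem_cls; exists a; reflexivity.
  + exists b; apply bisim_sym, cls_eq, Hb.
- intro b; destruct (proj1 (mem_cls (cls (g b)) (node A f))) as [a Ha].
  + apply H, mem_cls; exists b; reflexivity.
  + exists a; apply cls_eq, Ha.
Qed.

Lemma mem_ind (P : V -> Prop) :
  (forall x, (forall z, z ∈ x -> P z) -> P x) -> forall x, P x.
Proof.
intros H x; rewrite <- (reprK x); induction (repr x) as [A f IH].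
apply H; intros z Hz; destruct (proj1 (mem_cls _ _) Hz) as [a <-]; apply IH.
Qed.

(** * Basic operations *)

Definition empty : V := family (fun e : Empty_set => match e with end).

Definition sep (x : V) (P : V -> Prop) : V :=
  family (fun i : {i : index x | P (elt x i)} => elt x (proj1_sig i)).

Definition upair (a b : V) : V := family (fun i : bool => if i then a else b).

Definition union (x : V) : V :=
  family (fun i : {i : index x & index (elt x i)} =>
    elt (elt x (projT1 i)) (projT2 i)).

Definition powerset (x : V) : V :=
  family (fun p : index x -> Prop =>
    family (fun i : {i : index x | p i} => elt x (proj1_sig i))).

Definition inter (x y : V) : V := sep x (fun z => z ∈ y).
Notation "x ∩ y" := (inter x y) (at level 40, left associativity) : set_scope.

Definition succ (x : V) : V := union (upair x (upair x x)).

Fixpoint numeral (n : nat) : V :=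
  match n with O => empty | S m => succ (numeral m) end.

Definition omega : V := family numeral.

Definition opair (a b : V) : V := upair (upair a a) (upair a b).

Lemma mem_empty z : ~ z ∈ empty.
Proof. intro H; apply mem_family in H as [[] _]. Qed.

Lemma mem_sep x P z : z ∈ sep x P <-> z ∈ x /\ P z.
Proof.
unfold sep; rewrite mem_family; split.
- intros [[i Hi] <-]; split; [exists i; reflexivity | exact Hi].
- intros [[i <-] Hi]; exists (exist _ i Hi); reflexivity.
Qed.

Lemma mem_upair a b z : z ∈ upair a b <-> z = a \/ z = b.
Proof.
unfold upair; rewrite mem_family; split.
- intros [[] <-]; auto.
- intros [-> | ->]; [exists true | exists false]; reflexivity.
Qed.

Lemma mem_union x z : z ∈ union x <-> exists y, y ∈ x /\ z ∈ y.
Proof.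
unfold union; rewrite mem_family; split.
- intros [[i j] <-]; exists (elt x i).
  split; [exists i | exists j]; reflexivity.
- intros [y [[i <-] [j <-]]]; exists (existT _ i j); reflexivity.
Qed.

Lemma mem_powerset x z : z ∈ powerset x <-> z ⊆ x.
Proof.
unfold powerset; rewrite mem_family; split.
- intros [p <-] u Hu; apply mem_family in Hu as [[i Hi] <-].
  exists i; reflexivity.
- intro H; exists (fun i => elt x i ∈ z).
  apply extensionality; intro u; rewrite mem_family; split.
  + intros [[i Hi] <-]; exact Hi.
  + intro Hu; destruct (H u Hu) as [i <-].
    exists (exist _ i Hu); reflexivity.
Qed.

Lemma mem_inter x y z : z ∈ x ∩ y <-> z ∈ x /\ z ∈ y.
Proof. exact (mem_sep x (fun z => z ∈ y) z). Qed.

Lemma mem_succ x z : z ∈ succ x <-> z ∈ x \/ z = x.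
Proof.
unfold succ; rewrite mem_union; split.
- intros [y [Hy Hz]]; apply mem_upair in Hy as [-> | ->]; auto.
  apply mem_upair in Hz; tauto.
- intros [Hz | ->]; [exists x | exists (upair x x)]; rewrite !mem_upair; auto.
Qed.

Lemma mem_omega z : z ∈ omega <-> exists n, numeral n = z.
Proof. exact (mem_family _ numeral z). Qed.

Lemma opair_inj a b c d : opair a b = opair c d -> a = c /\ b = d.
Proof.
intro H.
assert (K : forall z, z = upair a a \/ z = upair a b <->
                      z = upair c c \/ z = upair c d).
{ intro z; rewrite <- !mem_upair; fold (opair a b) (opair c d).
  rewrite H; tauto. }
assert (E : forall p q r s, upair p q = upair r s ->
            forall z, z = p \/ z = q <-> z = r \/ z = s).
{ intros p q r s Hp z; rewrite <- !mem_upair, Hp; tauto. }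
assert (Hac : a = c).
{ destruct (proj1 (K (upair a a)) (or_introl eq_refl)) as [J | J];
    pose proof (proj2 (E _ _ _ _ J c) (or_introl eq_refl)); intuition. }
subst c; split; [reflexivity|].
destruct (proj1 (K (upair a b)) (or_intror eq_refl)) as [J | J];
  pose proof (proj1 (E _ _ _ _ J b) (or_intror eq_refl)) as Eb;
  destruct (proj2 (K (upair a d)) (or_intror eq_refl)) as [L | L];
  pose proof (proj1 (E _ _ _ _ L d) (or_intror eq_refl)) as Ed;
  intuition congruence.
Qed.

(** * Functions, ordinals, cardinals *)

Definition maps_to (f x y : V) : Prop := opair x y ∈ f.

Definition is_function (f a b : V) : Prop :=
  (forall p, p ∈ f -> exists x y, x ∈ a /\ y ∈ b /\ p = opair x y) /\
  (forall x, x ∈ a -> exists! y, maps_to f x y).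

Definition is_injection (f a b : V) : Prop :=
  is_function f a b /\
  (forall x x' y, maps_to f x y -> maps_to f x' y -> x = x').

Definition is_bijection (f a b : V) : Prop :=
  is_injection f a b /\ (forall y, y ∈ b -> exists x, maps_to f x y).

Definition equinumerous (a b : V) : Prop := exists f, is_bijection f a b.

Definition transitive_set (x : V) : Prop := forall y, y ∈ x -> y ⊆ x.

(* Transitive and strictly well-ordered by membership. *)
Definition ordinal (a : V) : Prop :=
  transitive_set a /\
  (forall x, x ∈ a -> ~ x ∈ x) /\
  (forall x y z, x ∈ a -> y ∈ a -> z ∈ a -> x ∈ y -> y ∈ z -> x ∈ z) /\
  (forall u, u ⊆ a -> u <> empty ->
     exists m, m ∈ u /\ forall z, z ∈ u -> m = z \/ m ∈ z).

(* The order of the ordinals. *)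
Definition ord_le (a b : V) : Prop := a ∈ b \/ a = b.

Definition cardinal (k : V) : Prop :=
  ordinal k /\ forall a, a ∈ k -> ~ equinumerous a k.

Definition cardinality (x k : V) : Prop := cardinal k /\ equinumerous x k.

Definition successor_cardinal (k l : V) : Prop :=
  cardinal l /\ k ∈ l /\ forall m, cardinal m -> k ∈ m -> ord_le l m.

Definition cofinal_map (f a b : V) : Prop :=
  is_function f a b /\
  forall y, y ∈ b -> exists x z, maps_to f x z /\ ord_le y z.

Definition cofinality (b a : V) : Prop :=
  ordinal a /\ (exists f, cofinal_map f a b) /\
  forall a', a' ∈ a -> ~ exists f, cofinal_map f a' b.

Definition regular_cardinal (k : V) : Prop :=
  cardinal k /\ ord_le omega k /\ cofinality k k.

Definition countable (x : V) : Prop := exists f, is_injection f x omega.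

(** * The structure H(theta) and elementarity *)

Definition transitive_closure (x t : V) : Prop :=
  x ⊆ t /\ transitive_set t /\
  forall u, x ⊆ u -> transitive_set u -> t ⊆ u.

(* H(theta): the sets whose transitive closure has cardinality less than [theta]. *)
Definition Hered (theta x : V) : Prop :=
  exists t k, transitive_closure x t /\ cardinality t k /\ k ∈ theta.

(* First-order formulas of the language of set theory; de Bruijn indices. *)
Inductive formula : Type :=
| Fmem (i j : nat)
| Feq (i j : nat)
| Fnot (p : formula)
| Fand (p q : formula)
| Fall (p : formula).

Definition push (a : V) (s : nat -> V) (n : nat) : V :=
  match n with O => a | S m => s m end.

Fixpoint sat (M : V -> Prop) (s : nat -> V) (p : formula) : Prop :=
  match p with
  | Fmem i j => s i ∈ s j
  | Feq i j => s i = s j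
  | Fnot p => ~ sat M s p
  | Fand p q => sat M s p /\ sat M s q
  | Fall p => forall a, M a -> sat M (push a s) p
  end.

Definition elementary_substructure (N M : V -> Prop) : Prop :=
  (exists a, N a) /\
  (forall a, N a -> M a) /\
  forall p s, (forall n, N (s n)) -> (sat N s p <-> sat M s p).

(** * Guessing and internally unbounded sets *)

(* [x] belongs to [N]^omega, the set of countably infinite subsets of [N]. *)
Definition in_Pomega (N x : V) : Prop := x ⊆ N /\ equinumerous x omega.

Definition bounded_in (M x : V) : Prop := exists Y, Y ∈ M /\ x ⊆ Y.

Definition guessing (N : V) : Prop :=
  forall x, x ⊆ N -> bounded_in N x ->
    (forall a, a ∈ N -> in_Pomega N a -> x ∩ a ∈ N) ->
    exists E, E ∈ N /\ x = N ∩ E.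

Definition internally_unbounded (N : V) : Prop :=
  forall x, x ⊆ N -> countable x -> bounded_in N x ->
    exists y, y ∈ N /\ in_Pomega N y /\ x ⊆ y.

(* Main.v *)
(** After replacing [x] by [x ∪ omega], enumerate [x] injectively and let [x_n] be
    the set of its first [n] elements.  The finite sets [x_n] belong to [N], as
    does [[X]^{<omega}] for a bound [X] of [x].  If some countable [a] in [N]
    contains infinitely many [x_n], then the union of the finite sets belonging to
    [a] covers [x].  Otherwise every such [a] meets [{x_n | n < omega}] in a finite
    set, so that [{x_n | n < omega} = N ∩ E] with [E] in [N] and
    [E ⊆ [X]^{<omega}].  By elementarity [E] is a chain of finite sets, so each of
    its members lies below some [x_n]; hence [E = {x_n | n < omega}] and
    [x = ⋃ E] is itself in [N]. *)

From Stdlib Require Import Classical ClassicalEpsilon FunctionalExtensionality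
  PropExtensionality List Arith Lia Cantor FinFun.
Require Import Defs.

(** * Choice, foundation and functions as sets *)

Definition pick (P : V -> Prop) : V := epsilon (inhabits empty) P.

Lemma pickP (P : V -> Prop) : (exists z, P z) -> P (pick P).
Proof. apply epsilon_spec. Qed.

Lemma mem_irrefl x : ~ x ∈ x.
Proof. induction x as [x IH] using mem_ind; intro H; exact (IH x H H). Qed.

(** This form of foundation permits [Fix], hence recursion along membership. *)
Lemma mem_wf : well_founded mem.
Proof. intro x; induction x as [x IH] using mem_ind; constructor; exact IH. Qed.

Lemma empty_or_mem x : x = empty \/ exists z, z ∈ x.
Proof.
destruct (classic (exists z, z ∈ x)) as [H | H]; [now right | left].
apply extensionality; intro z; split; intro Hz.
- exfalso; eauto.
- exfalso; exact (mem_empty z Hz).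
Qed.

Definition insert (a s : V) : V := union (upair s (upair a a)).

Lemma mem_insert a s z : z ∈ insert a s <-> z ∈ s \/ z = a.
Proof.
unfold insert; rewrite mem_union; split.
- intros [y [Hy Hz]]; apply mem_upair in Hy as [-> | ->]; auto.
  apply mem_upair in Hz; tauto.
- intros [Hz | ->]; [exists s | exists (upair a a)]; rewrite !mem_upair; auto.
Qed.

Definition cup (x y : V) : V := union (upair x y).

Lemma mem_cup x y z : z ∈ cup x y <-> z ∈ x \/ z ∈ y.
Proof.
unfold cup; rewrite mem_union; split.
- intros [u [Hu Hz]]; apply mem_upair in Hu as [-> | ->]; auto.
- intros [Hz | Hz]; [exists x | exists y]; rewrite mem_upair; auto.
Qed.

Definition graph (F : V -> V) (a : V) : V :=
  family (fun i : index a => opair (elt a i) (F (elt a i))).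

Lemma maps_to_graph F a x y : maps_to (graph F a) x y <-> x ∈ a /\ y = F x.
Proof.
unfold maps_to, graph; rewrite mem_family; split.
- intros [i Hi]; apply opair_inj in Hi as [<- <-].
  split; [exists i|]; reflexivity.
- intros [[i <-] ->]; exists i; reflexivity.
Qed.

Lemma graph_function F a b :
  (forall x, x ∈ a -> F x ∈ b) -> is_function (graph F a) a b.
Proof.
intro H; split.
- intros p Hp; unfold graph in Hp; rewrite mem_family in Hp; destruct Hp as [i <-].
  assert (Hi : elt a i ∈ a) by (exists i; reflexivity).
  exists (elt a i), (F (elt a i)); auto.
- intros x Hx; exists (F x); split.
  + now apply maps_to_graph.
  + intros y Hy; apply maps_to_graph in Hy; now symmetry.
Qed.

Lemma function_range f a b x y : is_function f a b -> maps_to f x y -> x ∈ a /\ y ∈ b.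
Proof.
intros [H _] Hxy; destruct (H _ Hxy) as (x' & y' & Hx & Hy & E).
apply opair_inj in E as [-> ->]; auto.
Qed.

(** * Equinumerosity through functions on [V] *)

(** Mutually inverse Rocq functions instead of a set of pairs, so that bijections compose and invert
    directly. Values outside [a] and [b] are arbitrary. *)
Definition equi (a b : V) : Prop :=
  exists F G : V -> V,
    (forall x, x ∈ a -> F x ∈ b /\ G (F x) = x) /\
    (forall y, y ∈ b -> G y ∈ a /\ F (G y) = y).

Lemma equi_sym a b : equi a b -> equi b a.
Proof. intros (F & G & H & K); exists G, F; auto. Qed.

Lemma equi_trans a b c : equi a b -> equi b c -> equi a c.
Proof.
intros (F & G & H & K) (F' & G' & H' & K').
exists (fun x => F' (F x)), (fun y => G (G' y)); split.
- intros x Hx; destruct (H x Hx) as [Hb E], (H' _ Hb) as [Hc E'].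
  now rewrite E', E.
- intros y Hy; destruct (K' y Hy) as [Hb E], (K _ Hb) as [Ha E'].
  now rewrite E', E.
Qed.

Lemma equi_of_bij a b (F : V -> V) :
  (forall x, x ∈ a -> F x ∈ b) ->
  (forall x x', x ∈ a -> x' ∈ a -> F x = F x' -> x = x') ->
  (forall y, y ∈ b -> exists x, x ∈ a /\ F x = y) ->
  equi a b.
Proof.
intros H1 H2 H3; exists F, (fun y => pick (fun x => x ∈ a /\ F x = y)); split.
- intros x Hx; split; auto.
  destruct (pickP (fun u => u ∈ a /\ F u = F x)) as [Ha E]; eauto.
- intros y Hy; exact (pickP _ (H3 y Hy)).
Qed.

Lemma equinumerousE a b : equinumerous a b <-> equi a b.
Proof.
split.
- intros [f [[Hf Hinj] Hsur]].
  assert (HF : forall x, x ∈ a -> maps_to f x (pick (maps_to f x))).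
  { intros x Hx; apply pickP.
    destruct (proj2 Hf x Hx) as [y [Hy _]]; eauto. }
  apply equi_of_bij with (fun x => pick (maps_to f x)).
  + intros x Hx; exact (proj2 (function_range _ _ _ _ _ Hf (HF x Hx))).
  + intros x x' Hx Hx' E; apply Hinj with (pick (maps_to f x)); auto.
    rewrite E; auto.
  + intros y Hy; destruct (Hsur y Hy) as [x Hx]; exists x.
    destruct (function_range _ _ _ _ _ Hf Hx) as [Ha _]; split; auto.
    destruct (proj2 Hf x Ha) as [z [_ Hz]].
    now rewrite <- (Hz _ Hx), <- (Hz _ (HF x Ha)).
- intros (F & G & H & K); exists (graph F a); split; [split|].
  + apply graph_function; intros x Hx; now apply H.
  + intros x x' y Hx Hx'; apply maps_to_graph in Hx as [Hx ->], Hx' as [Hx' E].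
    rewrite <- (proj2 (H x Hx)), E; now apply H.
  + intros y Hy; exists (G y); apply maps_to_graph.
    destruct (K y Hy) as [Ha E]; auto.
Qed.

(** * Ordinals and numerals *)

(** The least element of the pair of [x] and [y] decides the comparison. *)
Lemma ordinal_trichotomy a x y :
  ordinal a -> x ∈ a -> y ∈ a -> x = y \/ x ∈ y \/ y ∈ x.
Proof.
intros (_ & _ & _ & Hmin) Hx Hy.
destruct (Hmin (upair x y)) as [m [Hm Hle]].
- intros z Hz; apply mem_upair in Hz as [-> | ->]; auto.
- intro E; apply (mem_empty x); rewrite <- E; apply mem_upair; auto.
- pose proof (Hle x (proj2 (mem_upair x y x) (or_introl eq_refl))).
  pose proof (Hle y (proj2 (mem_upair x y y) (or_intror eq_refl))).
  apply mem_upair in Hm as [-> | ->]; intuition.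
Qed.

Lemma ordinal_mem a k : ordinal a -> k ∈ a -> ordinal k.
Proof.
intros (Ht & Hi & Htr & Hmin) Hk; assert (Hka : k ⊆ a) by now apply Ht.
repeat split.
- intros y Hy z Hz; apply Htr with y; auto; apply (Ht y); auto.
- auto.
- intros x y z Hx Hy Hz; apply Htr; auto.
- intros u Hu; apply Hmin; intros z Hz; auto.
Qed.

(** Membership induction on a witness: it is minimal, or some member of it, again in [a] by
    transitivity, satisfies [P]. *)
Lemma ordinal_least a (P : V -> Prop) :
  ordinal a -> (exists x, x ∈ a /\ P x) ->
  exists m, m ∈ a /\ P m /\ forall z, z ∈ m -> ~ P z.
Proof.
intros Ha [x [Hx Px]]; revert Hx Px.
induction x as [x IH] using mem_ind; intros Hx Px.
destruct (classic (exists z, z ∈ x /\ P z)) as [[z [Hz Pz]] | H].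
- apply (IH z Hz); auto; now apply (proj1 Ha x).
- exists x; repeat split; auto; intros z Hz Pz; eauto.
Qed.

Lemma numeral_lt m n : m < n -> numeral m ∈ numeral n.
Proof. induction 1; simpl; apply mem_succ; auto. Qed.

Lemma numeral_inj m n : numeral m = numeral n -> m = n.
Proof.
intro E; destruct (lt_eq_lt_dec m n) as [[H | H] | H]; auto;
  apply numeral_lt in H; rewrite E in H; destruct (mem_irrefl _ H).
Qed.

Lemma numeral_omega n : numeral n ∈ omega.
Proof. apply mem_omega; eauto. Qed.

Definition denumeral (m : V) : nat := epsilon (inhabits 0) (fun n => numeral n = m).

Lemma denumeralK m : m ∈ omega -> numeral (denumeral m) = m.
Proof.
intro H; apply mem_omega in H; exact (epsilon_spec (inhabits 0) _ H).
Qed.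

Lemma numeralK n : denumeral (numeral n) = n.
Proof. apply numeral_inj, denumeralK, numeral_omega. Qed.

(** * Finite, enumerable and infinite sets *)

Fixpoint set_of (l : list V) : V :=
  match l with nil => empty | a :: l => insert a (set_of l) end.

Lemma mem_set_of l z : z ∈ set_of l <-> In z l.
Proof.
induction l as [|a l IH]; simpl.
- split; [apply mem_empty | tauto].
- rewrite mem_insert, IH; intuition.
Qed.

(* The finite subsets of [X], written [X]^{<omega} above. *)
Definition finsub (X : V) : V :=
  family (fun l : list (index X) => set_of (map (elt X) l)).

Lemma mem_finsub X s :
  s ∈ finsub X <-> exists l, (forall z, In z l -> z ∈ X) /\ s = set_of l.
Proof.
unfold finsub; rewrite mem_family; split.
- intros [l <-]; exists (map (elt X) l); split; auto.
  intros z Hz; apply in_map_iff in Hz as [i [<- _]]; exists i; reflexivity.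
- intros [l [Hl ->]]; enough (exists k, map (elt X) k = l) as [k <-] by eauto.
  induction l as [|a l IH]; [now exists nil|].
  destruct IH as [k Hk]; [intros z Hz; apply Hl; now right|].
  destruct (Hl a (or_introl eq_refl)) as [i Hi]; exists (i :: k); simpl; congruence.
Qed.

(** Repetitions and values outside [y] are allowed, so the empty set and subsets need no separate
    treatment. *)
Definition enumerable (y : V) : Prop :=
  exists e : nat -> V, forall z, z ∈ y -> exists n, e n = z.

Definition infinite (y : V) : Prop := forall l, exists z, z ∈ y /\ ~ In z l.

Lemma enumerable_subset x y : x ⊆ y -> enumerable y -> enumerable x.
Proof. intros H [e He]; exists e; auto. Qed.

Lemma enumerable_set_of l : enumerable (set_of l).
Proof.
exists (fun n => nth n l empty); intros z Hz; apply mem_set_of in Hz.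
destruct (In_nth l z empty Hz) as [n [_ Hn]]; eauto.
Qed.

Lemma enumerable_countable x : countable x -> enumerable x.
Proof.
intros [f [Hf Hinj]]; exists (fun n => pick (fun z => maps_to f z (numeral n))).
intros z Hz; destruct (proj2 Hf z Hz) as [y [Hy _]].
destruct (function_range _ _ _ _ _ Hf Hy) as [_ Hw].
apply mem_omega in Hw as [n <-]; exists n.
apply Hinj with (numeral n); auto.
apply (pickP (fun z => maps_to f z (numeral n))); eauto.
Qed.

Lemma enumerable_omega : enumerable omega.
Proof. exists numeral; intros z; apply mem_omega. Qed.

Lemma enumerable_equinumerous y : equinumerous y omega -> enumerable y.
Proof. intros [f [Hf _]]; apply enumerable_countable; now exists f. Qed.

(** The Cantor pairing combines an enumeration of [a] with chosen enumerations of its members. *)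
Lemma enumerable_union a :
  enumerable a -> (forall s, s ∈ a -> enumerable s) -> enumerable (union a).
Proof.
intros [e He] Hs.
pose (P s (d : nat -> V) := forall z, z ∈ s -> exists n, d n = z).
pose (d s := epsilon (inhabits (fun _ => empty)) (P s)).
exists (fun n => let (i, j) := of_nat n in d (e i) j).
intros z Hz; apply mem_union in Hz as [s [Hsa Hz]].
destruct (He s Hsa) as [i Hi].
assert (Hd : P s (d s)) by apply epsilon_spec, Hs, Hsa.
destruct (Hd z Hz) as [j Hj]; exists (to_nat (i, j)).
now rewrite cancel_of_to, Hi.
Qed.

Lemma enumerable_cup x y : enumerable x -> enumerable y -> enumerable (cup x y).
Proof.
intros Hx Hy; apply enumerable_union.
- exists (fun n => match n with 0 => x | _ => y end).
  intros z Hz; apply mem_upair in Hz as [-> | ->]; [now exists 0 | now exists 1].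
- intros s Hs; apply mem_upair in Hs as [-> | ->]; auto.
Qed.

(** The pigeonhole principle for lists. *)
Lemma incl_length_inj (e : nat -> V) n l :
  (forall i j, e i = e j -> i = j) -> incl (map e (seq 0 n)) l -> n <= length l.
Proof.
intros He Hl; rewrite <- (length_seq n 0), <- (length_map e).
apply NoDup_incl_length; auto.
apply Injective_map_NoDup; [exact He | apply seq_NoDup].
Qed.

Lemma infinite_inj y (e : nat -> V) :
  (forall n, e n ∈ y) -> (forall i j, e i = e j -> i = j) -> infinite y.
Proof.
intros Hy He l; apply NNPP; intro H.
enough (S (length l) <= length l) by lia.
apply (incl_length_inj e); auto.
intros z Hz; apply in_map_iff in Hz as [n [<- _]].
apply NNPP; intro K; apply H; eauto.
Qed.

Lemma infinite_omega : infinite omega.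
Proof. apply infinite_inj with numeral; [exact numeral_omega | exact numeral_inj]. Qed.

Lemma infinite_superset x y : x ⊆ y -> infinite x -> infinite y.
Proof. intros Hxy Hx l; destruct (Hx l) as [z [Hz Hl]]; eauto. Qed.

Lemma nat_least (P : nat -> Prop) :
  (exists n, P n) -> exists n, P n /\ forall m, P m -> n <= m.
Proof.
intros [n Hn]; induction n as [n IH] using lt_wf_ind.
destruct (classic (exists m, m < n /\ P m)) as [[m [Hm Pm]] | H]; eauto.
exists n; split; auto; intros m Pm; apply Nat.nlt_ge; intro; apply H; eauto.
Qed.

Lemma enumerate y :
  enumerable y -> infinite y ->
  exists e : nat -> V,
    (forall n, e n ∈ y) /\ (forall i j, e i = e j -> i = j) /\
    (forall z, z ∈ y -> exists n, e n = z).
Proof.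
intros [d Hd] Hinf.
(* Enumerate increasingly the indices at which [d] takes a value of [y] for the first time. *)
pose (new k := d k ∈ y /\ forall j, j < k -> d j <> d k).
assert (HS : forall z, z ∈ y -> exists k, new k /\ d k = z).
{ intros z Hz; destruct (nat_least (fun k => d k = z) (Hd z Hz)) as [k [<- Hk]].
  exists k; repeat split; auto; intros j Hj E; apply Hk in E; lia. }
assert (Sinj : forall j k, new j -> new k -> d j = d k -> j = k).
{ intros j k [_ Hj] [_ Hk] E.
  destruct (lt_eq_lt_dec j k) as [[L | L] | L]; auto; exfalso; firstorder. }
(* The first [m] values of [d] do not exhaust the infinite set [y], so some first occurrence has
   index at least [m]. *)
assert (Sunb : forall m, exists k, (m <= k /\ new k) /\ forall j, m <= j /\ new j -> k <= j).
{ intro m; apply nat_least.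
  destruct (Hinf (map d (seq 0 m))) as [z [Hz Hl]].
  destruct (HS z Hz) as [k [Hk <-]]; exists k; split; auto.
  apply Nat.nlt_ge; intro L; apply Hl, in_map, in_seq; lia. }
pose (nx m := epsilon (inhabits 0)
  (fun k => (m <= k /\ new k) /\ forall j, m <= j /\ new j -> k <= j)).
assert (Hnx : forall m, (m <= nx m /\ new (nx m)) /\ forall j, m <= j /\ new j -> nx m <= j).
{ intro m; exact (epsilon_spec (inhabits 0) _ (Sunb m)). }
pose (c := nat_rect (fun _ => nat) (nx 0) (fun _ k => nx (k + 1))).
assert (cS : forall n, new (c n)) by (intros [|n]; simpl; apply Hnx).
assert (cstep : forall n, c n < c (n + 1)).
{ intro n; rewrite Nat.add_1_r; simpl; pose proof (proj1 (proj1 (Hnx (c n + 1)))); lia. }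
assert (cmono : forall m n, m < n -> c m < c n).
{ induction 1 as [|n _ IH]; [|transitivity (c n); auto];
    rewrite <- Nat.add_1_r; apply cstep. }
assert (cge : forall n, n <= c n).
{ induction n as [|n IH]; [lia|]; pose proof (cmono n (n + 1)).
  rewrite <- Nat.add_1_r; lia. }
(* A first occurrence strictly between two consecutive values of [c] would contradict the minimality
   of [nx]. *)
assert (csur : forall k m, new k -> k < c m -> exists n, c n = k).
{ intros k m Hk; induction m as [|m IH]; intro L; simpl in L.
  - pose proof (proj2 (Hnx 0) k (conj (Nat.le_0_l k) Hk)); lia.
  - destruct (lt_eq_lt_dec k (c m)) as [[K | K] | K]; eauto.
    assert (K' : c m + 1 <= k) by lia.
    pose proof (proj2 (Hnx (c m + 1)) k (conj K' Hk)); fold c in L; lia. }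
exists (fun n => d (c n)); split; [|split].
- intro n; apply cS.
- intros i j E; apply Sinj in E; auto.
  destruct (lt_eq_lt_dec i j) as [[L | L] | L]; auto; apply cmono in L; lia.
- intros z Hz; destruct (HS z Hz) as [k [Hk <-]].
  destruct (csur k (k + 1)) as [n <-]; eauto.
  pose proof (cge (k + 1)); lia.
Qed.

Lemma equinumerous_omega y : enumerable y -> infinite y -> equinumerous y omega.
Proof.
intros He Hi; destruct (enumerate y He Hi) as (e & Hy & Hinj & Hsur).
apply equinumerousE, equi_sym, equi_of_bij with (fun m => e (denumeral m)).
- auto.
- intros m n Hm Hn E; apply Hinj in E.
  now rewrite <- (denumeralK m Hm), E, denumeralK.
- intros z Hz; destruct (Hsur z Hz) as [n <-]; exists (numeral n).
  rewrite numeralK; auto using numeral_omega.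
Qed.

(** * Small sets *)

(* For regular [theta] this says that [x] has cardinality less than [theta];
   in this form closure under unions needs no cardinal arithmetic. *)
Definition small (theta x : V) : Prop :=
  forall h : V -> V, (forall z, z ∈ x -> h z ∈ theta) ->
    exists b, b ∈ theta /\ forall z, z ∈ x -> h z ∈ b.

Section Small.
Context (theta : V) (Htheta : regular_cardinal theta) (Homega : omega ∈ theta).

Lemma small_subset x y : x ⊆ y -> small theta y -> small theta x.
Proof.
intros Hxy Hy h Hh.
(* Outside [x] the default value is [omega], a member of [theta]. *)
pose (h' z := if excluded_middle_informative (z ∈ x) then h z else omega).
destruct (Hy h') as [b [Hb K]].
- intros z _; unfold h'; destruct excluded_middle_informative; auto.
- exists b; split; auto; intros z Hz; generalize (K z (Hxy z Hz)); unfold h'.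
  now destruct excluded_middle_informative.
Qed.

(** Choose for each [a] a bound of [h] on the piece [R a]. These bounds form a function on the small
    set [A]; a bound of it dominates [h], since members of [theta] are transitive. *)
Lemma small_cover A x (R : V -> V -> Prop) :
  small theta A ->
  (forall z, z ∈ x -> exists a, a ∈ A /\ R a z) ->
  (forall a, a ∈ A -> small theta (sep x (R a))) ->
  small theta x.
Proof.
intros HA Hx HB h Hh.
pose (P a b := b ∈ theta /\ forall z, z ∈ sep x (R a) -> h z ∈ b).
assert (HP : forall a, a ∈ A -> P a (pick (P a))).
{ intros a Ha; apply pickP, HB; auto.
  intros z Hz; apply mem_sep in Hz; apply Hh, Hz. }
destruct (HA (fun a => pick (P a))) as [b [Hb K]].
- intros a Ha; exact (proj1 (HP a Ha)).
- exists b; split; auto; intros z Hz; destruct (Hx z Hz) as [a [Ha Ra]].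
  apply (proj1 (ordinal_mem _ _ (proj1 (proj1 Htheta)) Hb) _ (K a Ha)).
  apply (HP a Ha), mem_sep; auto.
Qed.

Lemma small_image A x (F : V -> V) :
  small theta A -> (forall z, z ∈ x -> exists a, a ∈ A /\ z = F a) -> small theta x.
Proof.
intros HA Hx h Hh.
pose (y := sep A (fun a => F a ∈ x)).
destruct (small_subset y A) with (h := fun a => h (F a)) as [b [Hb K]]; auto.
- intros z Hz; now apply mem_sep in Hz.
- intros z Hz; apply Hh; now apply mem_sep in Hz.
- exists b; split; auto; intros z Hz; destruct (Hx z Hz) as [a [Ha ->]].
  apply K, mem_sep; auto.
Qed.

(** Regularity enters here: the graph of an unbounded [h] would be a cofinal map from [k] to
    [theta]. *)
Lemma small_mem k : k ∈ theta -> small theta k.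
Proof.
intros Hk h Hh; apply NNPP; intro Hb.
apply (proj2 (proj2 (proj2 (proj2 Htheta))) k Hk).
exists (graph h k); split; [now apply graph_function|].
intros y Hy; apply NNPP; intro Hz; apply Hb; exists y; split; auto.
intros x Hx.
destruct (ordinal_trichotomy theta y (h x)) as [E | [E | E]]; auto.
- apply Htheta.
- destruct Hz; exists x, (h x); split; [now apply maps_to_graph | now right].
- destruct Hz; exists x, (h x); split; [now apply maps_to_graph | now left].
Qed.

Lemma small_omega : small theta omega.
Proof. now apply small_mem. Qed.

Lemma small_nat_cover x (R : nat -> V -> Prop) :
  (forall z, z ∈ x -> exists n, R n z) ->
  (forall n, small theta (sep x (R n))) -> small theta x.
Proof.
intros Hx HR; apply small_cover with omega (fun m => R (denumeral m)); auto.
- exact small_omega.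
- intros z Hz; destruct (Hx z Hz) as [n Hn]; exists (numeral n).
  rewrite numeralK; auto using numeral_omega.
Qed.

Lemma small_nat_range x (F : nat -> V) :
  (forall z, z ∈ x -> exists n, z = F n) -> small theta x.
Proof.
intro H; apply small_image with omega (fun m => F (denumeral m)).
- exact small_omega.
- intros z Hz; destruct (H z Hz) as [n ->]; exists (numeral n).
  rewrite numeralK; auto using numeral_omega.
Qed.

Lemma small_cup x y : small theta x -> small theta y -> small theta (cup x y).
Proof.
intros Hx Hy; apply small_nat_cover with (fun n z => z ∈ match n with 0 => x | _ => y end).
- intros z Hz; apply mem_cup in Hz as [Hz | Hz]; [exists 0 | exists 1]; auto.
- intros [|n]; [apply small_subset with x | apply small_subset with y]; auto;
    intros z Hz; now apply mem_sep in Hz.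
Qed.

Lemma small_insert a x : small theta x -> small theta (insert a x).
Proof.
intro Hx; apply small_subset with (cup x (upair a a)).
- intros z Hz; apply mem_cup; rewrite mem_upair; apply mem_insert in Hz; tauto.
- apply small_cup; auto; apply small_nat_range with (fun _ => a).
  intros z Hz; exists 0; apply mem_upair in Hz; tauto.
Qed.

(* A small set is exhausted by fewer than [theta] successive choices. *)
Lemma small_equi_mem x : small theta x -> exists a, a ∈ theta /\ equi a x.
Proof.
intro Hx; pose proof (proj1 (proj1 Htheta)) as Hord.
(* Stage [a] picks an element of [x] not picked at any earlier stage. *)
pose (step a (F : forall b, b ∈ a -> V) :=
        pick (fun z => z ∈ x /\ forall b (H : b ∈ a), F b H <> z)).
pose (F := Fix mem_wf (fun _ => V) step).
assert (EF : forall a, F a = pick (fun z => z ∈ x /\ forall b, b ∈ a -> F b <> z)).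
{ intro a; unfold F at 1; rewrite Fix_eq; [reflexivity|].
  intros b f g Hfg; unfold step; f_equal.
  apply functional_extensionality; intro z; apply propositional_extensionality.
  split; intros [Hz K]; split; auto; intros c Hc; [rewrite <- Hfg | rewrite Hfg]; auto. }
pose (more a := exists z, z ∈ x /\ forall b, b ∈ a -> F b <> z).
assert (Fmore : forall a, more a -> F a ∈ x /\ forall b, b ∈ a -> F b <> F a).
{ intros a Ha; apply pickP in Ha; rewrite <- EF in Ha; exact Ha. }
assert (Finj : forall c, ordinal c -> (forall a, a ∈ c -> more a) ->
          forall a b, a ∈ c -> b ∈ c -> F a = F b -> a = b).
{ intros c Hc Hm a b Ha Hb E.
  destruct (ordinal_trichotomy c a b) as [K | [K | K]]; auto.
  - destruct (proj2 (Fmore b (Hm b Hb)) a K E).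
  - destruct (proj2 (Fmore a (Hm a Ha)) b K (eq_sym E)). }
destruct (classic (forall a, a ∈ theta -> more a)) as [Hall | Hnot].
- exfalso.
  (* If the choices never run out, [h] sends each chosen element to its stage. A bound [b] of [h] on
     [x] is itself a stage, and [h (F b) = b] yields [b ∈ b]. *)
  pose (h z := pick (fun a => a ∈ theta /\ ((exists b, b ∈ theta /\ F b = z) -> F a = z))).
  assert (Hh : forall z, h z ∈ theta /\ ((exists b, b ∈ theta /\ F b = z) -> F (h z) = z)).
  { intro z; apply (pickP (fun a => a ∈ theta /\ ((exists b, b ∈ theta /\ F b = z) -> F a = z))).
    destruct (classic (exists b, b ∈ theta /\ F b = z)) as [[b [Hb E]] | K].
    - exists b; auto.
    - exists omega; tauto. }
  destruct (Hx h) as [b [Hb K]]; [intros; apply Hh|].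
  assert (E : h (F b) = b).
  { apply (Finj theta); auto; [apply Hh | apply Hh; eauto]. }
  pose proof (K (F b) (proj1 (Fmore b (Hall b Hb)))) as L.
  rewrite E in L; exact (mem_irrefl _ L).
(* At the first stage [m] where [x] is exhausted, [F] is a bijection from [m] onto [x]. *)
- destruct (ordinal_least theta (fun a => ~ more a)) as (m & Hm & Nm & Lm); auto.
  { apply not_all_ex_not in Hnot as [a Ha]; exists a; tauto. }
  assert (Hmore : forall a, a ∈ m -> more a) by (intros a Ha; apply NNPP; auto).
  exists m; split; auto; apply equi_of_bij with F.
  + intros a Ha; now apply Fmore, Hmore.
  + apply Finj; auto; now apply ordinal_mem with theta.
  + intros z Hz; apply NNPP; intro K; apply Nm; exists z; split; auto.
    intros b Hb E; apply K; eauto.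
Qed.

Lemma small_cardinality x : small theta x -> exists k, cardinality x k /\ k ∈ theta.
Proof.
intro Hx; pose proof (proj1 (proj1 Htheta)) as Hord.
destruct (ordinal_least theta (fun a => equi a x)) as (k & Hk & Ek & Lk); auto.
{ now apply small_equi_mem. }
exists k; split; auto; split; [split|].
- now apply ordinal_mem with theta.
- intros a Ha Ea; apply (Lk a Ha), equi_trans with k; auto; now apply equinumerousE.
- now apply equinumerousE, equi_sym.
Qed.

(** * Closure properties of H(theta) *)

(** Any small transitive set containing [x] certifies membership in H(theta), so the closure
    properties below never compute a transitive closure or a cardinality. *)
Lemma HeredE x :
  Hered theta x <-> exists t, x ∈ t /\ transitive_set t /\ small theta t.
Proof.
split.
- intros (t & k & (Hxt & Ht & _) & [_ Hk] & Hkt).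
  exists (insert x t); split; [|split].
  + apply mem_insert; auto.
  + intros y Hy z Hz; apply mem_insert; left.
    apply mem_insert in Hy as [Hy | ->]; auto; now apply (Ht y).
  + apply small_insert.
    apply equinumerousE in Hk as (F & G & HF & _).
    apply small_image with k G; [now apply small_mem|].
    intros z Hz; exists (F z); split; [|symmetry]; now apply HF.
- intros (t & Hxt & Ht & Hs).
  (* The transitive closure of [x], cut out of [t]. *)
  pose (c := sep t (fun z => forall u, x ⊆ u -> transitive_set u -> z ∈ u)).
  destruct (small_cardinality c) as (k & Hck & Hk).
  { apply small_subset with t; auto; intros z Hz; now apply mem_sep in Hz. }
  exists c, k; split; auto; split; [|split].
  + intros z Hz; apply mem_sep; split; auto; now apply (Ht x).
  + intros y Hy z Hz; apply mem_sep in Hy as [Hy K]; apply mem_sep; split.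
    * now apply (Ht y).
    * intros u Hu Tu; apply (Tu y); auto.
  + intros u Hu Tu z Hz; apply mem_sep in Hz as [_ K]; auto.
Qed.

Lemma Hered_trans x z : Hered theta x -> z ∈ x -> Hered theta z.
Proof.
rewrite !HeredE; intros (t & Hx & Ht & Hs) Hz; exists t; split; auto.
now apply (Ht x).
Qed.

Lemma Hered_small x : Hered theta x -> small theta x.
Proof.
rewrite HeredE; intros (t & Hx & Ht & Hs); apply small_subset with t; auto.
Qed.

(** The union of chosen small transitive sets around the members of [x], with [x] itself added, is
    again small and transitive. *)
Lemma Hered_intro x :
  small theta x -> (forall z, z ∈ x -> Hered theta z) -> Hered theta x.
Proof.
intros Hs Hx; apply HeredE.
pose (P z t := z ∈ t /\ transitive_set t /\ small theta t).
assert (HP : forall z, z ∈ x -> P z (pick (P z))).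
{ intros z Hz; apply pickP, HeredE; auto. }
pose (U := union (family (fun i : index x => pick (P (elt x i))))).
assert (HU : forall w, w ∈ U <-> exists z, z ∈ x /\ w ∈ pick (P z)).
{ intro w; unfold U; rewrite mem_union; split.
  - intros [y [Hy Hw]]; rewrite mem_family in Hy; destruct Hy as [i <-].
    exists (elt x i); split; auto; exists i; reflexivity.
  - intros [z [[i <-] Hw]]; exists (pick (P (elt x i))); split; auto.
    apply mem_family; eauto. }
exists (insert x U); split; [|split].
- apply mem_insert; auto.
- intros y Hy z Hz; apply mem_insert; left; apply HU.
  apply mem_insert in Hy as [Hy | ->].
  + apply HU in Hy as [v [Hv Hy]]; exists v; split; auto.
    now apply (proj1 (proj2 (HP v Hv)) y).
  + exists z; split; auto; now apply HP.
- apply small_insert, small_cover with x (fun z w => w ∈ pick (P z)); auto.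
  + intros w Hw; now apply HU.
  + intros z Hz; apply small_subset with (pick (P z)).
    * intros w Hw; now apply mem_sep in Hw.
    * now apply HP.
Qed.

Lemma Hered_subset x y : Hered theta y -> x ⊆ y -> Hered theta x.
Proof.
intros Hy Hxy; apply Hered_intro.
- apply small_subset with y; auto; now apply Hered_small.
- intros z Hz; apply Hered_trans with y; auto.
Qed.

Lemma Hered_empty : Hered theta empty.
Proof.
apply Hered_intro; [apply small_nat_range with (fun _ => empty)|];
  intros z Hz; destruct (mem_empty z Hz).
Qed.

Lemma Hered_insert a x :
  Hered theta a -> Hered theta x -> Hered theta (insert a x).
Proof.
intros Ha Hx; apply Hered_intro; [now apply small_insert, Hered_small|].
intros z Hz; apply mem_insert in Hz as [Hz | ->]; auto; now apply Hered_trans with x.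
Qed.

Lemma Hered_cup x y : Hered theta x -> Hered theta y -> Hered theta (cup x y).
Proof.
intros Hx Hy; apply Hered_intro; [apply small_cup; now apply Hered_small|].
intros z Hz; apply mem_cup in Hz as [Hz | Hz]; eauto using Hered_trans.
Qed.

Lemma Hered_union x : Hered theta x -> Hered theta (union x).
Proof.
intro Hx; apply Hered_intro.
- apply small_cover with x (fun y z => z ∈ y); [now apply Hered_small| |].
  + intros z Hz; now apply mem_union.
  + intros y Hy; apply small_subset with y.
    * intros z Hz; now apply mem_sep in Hz.
    * now apply Hered_small, Hered_trans with x.
- intros z Hz; apply mem_union in Hz as [y [Hy Hz]]; eauto using Hered_trans.
Qed.

Lemma Hered_set_of l :
  (forall z, In z l -> Hered theta z) -> Hered theta (set_of l).
Proof.
induction l as [|a l IH]; simpl; intro H; [exact Hered_empty|].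
apply Hered_insert; auto.
Qed.

(** Stratify by list length. Each stratum arises from the previous one by inserting elements of [X],
    hence is small by induction, and there are only countably many strata. *)
Lemma small_finsub X : small theta X -> small theta (finsub X).
Proof.
intro HX.
pose (R n s := exists l, length l = n /\ (forall z, In z l -> z ∈ X) /\ s = set_of l).
apply small_nat_cover with R.
- intros s Hs; apply mem_finsub in Hs as (l & Hl & ->); exists (length l), l; auto.
- induction n as [|n IH].
  + apply small_nat_range with (fun _ => empty); intros s Hs; exists 0.
    apply mem_sep in Hs as [_ ([|] & Hl & _ & ->)]; [reflexivity | discriminate].
  + apply small_cover with X
      (fun a s => exists s', s' ∈ sep (finsub X) (R n) /\ s = insert a s'); auto.
    * intros s Hs; apply mem_sep in Hs as [_ ([|a l] & Hl & Hin & ->)]; [discriminate|].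
      exists a; split; [now apply Hin; left|]; exists (set_of l); split; auto.
      assert (Hin' : forall z, In z l -> z ∈ X) by (intros; apply Hin; now right).
      apply mem_sep; split; [apply mem_finsub|]; exists l; auto.
    * intros a _; apply small_image with (sep (finsub X) (R n)) (insert a); auto.
      intros s Hs; now apply mem_sep in Hs.
Qed.

Lemma Hered_finsub X : Hered theta X -> Hered theta (finsub X).
Proof.
intro HX; apply Hered_intro; [now apply small_finsub, Hered_small|].
intros s Hs; apply mem_finsub in Hs as (l & Hl & ->).
apply Hered_set_of; intros z Hz; apply Hered_trans with X; auto.
Qed.

End Small.

(** * Elementary submodels of H(theta) *)

Definition Fex p := Fnot (Fall (Fnot p)).
Definition For p q := Fnot (Fand (Fnot p) (Fnot q)).
Definition Fimp p q := Fnot (Fand p (Fnot q)).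
Definition Fiff p q := Fand (Fimp p q) (Fimp q p).

Lemma sat_ex M s p : sat M s (Fex p) <-> exists a, M a /\ sat M (push a s) p.
Proof.
simpl; split.
- intro H; apply NNPP; intro K; apply H; intros a Ha Hp; eauto.
- intros [a [Ha Hp]] H; exact (H a Ha Hp).
Qed.

Lemma sat_or M s p q : sat M s (For p q) <-> sat M s p \/ sat M s q.
Proof. simpl; tauto. Qed.

Lemma sat_imp M s p q : sat M s (Fimp p q) <-> (sat M s p -> sat M s q).
Proof. simpl; tauto. Qed.

Lemma sat_iff M s p q : sat M s (Fiff p q) <-> (sat M s p <-> sat M s q).
Proof. simpl; tauto. Qed.

#[local] Opaque Fex For Fimp Fiff.

Ltac sat_simpl :=
  cbn [sat push];
  repeat (first [ setoid_rewrite sat_ex | setoid_rewrite sat_or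
                | setoid_rewrite sat_iff | setoid_rewrite sat_imp ]; cbn [sat push]).

Section Elementary.
Context (theta : V) (Htheta : regular_cardinal theta) (Homega : omega ∈ theta).
Context (N : V) (HN : elementary_substructure (fun a => a ∈ N) (Hered theta)).

Lemma elem_Hered x : x ∈ N -> Hered theta x.
Proof. apply HN. Qed.

(** The Tarski-Vaught criterion: the existential statement passes down to [N], and the property of
    the witness found there passes back up. *)
Lemma elem_witness p s :
  (forall n, s n ∈ N) ->
  (exists z, Hered theta z /\ sat (Hered theta) (push z s) p) ->
  exists z, z ∈ N /\ sat (Hered theta) (push z s) p.
Proof.
intros Hs Hz; pose proof (proj2 (proj2 HN)) as El.
apply sat_ex in Hz; rewrite <- (El (Fex p) s Hs) in Hz; apply sat_ex in Hz.
destruct Hz as [z [Hz Hp]]; exists z; split; auto.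
apply El; auto; intros [|n]; simpl; auto.
Qed.

(* In [p] the variable 0 stands for the element and 2, 3, ... for the
   parameters [s]; the variable 1 stands for the set being defined. *)
Lemma elem_comprehension p s y :
  (forall n, s n ∈ N) -> Hered theta y ->
  (forall z w, Hered theta w -> (sat (Hered theta) (push w (push z s)) p <-> w ∈ y)) ->
  y ∈ N.
Proof.
intros Hs Hy Hp.
destruct (elem_witness (Fall (Fiff (Fmem 0 1) p)) s Hs) as [z [Hz E]].
- exists y; split; auto; intros w Hw; rewrite sat_iff.
  rewrite (Hp y w Hw); reflexivity.
(* H(theta) is transitive, so agreement on its elements gives equality. *)
- replace y with z; auto; apply extensionality; intro w.
  assert (K : Hered theta w -> (w ∈ z <-> w ∈ y)).
  { intro Hw; pose proof (E w Hw) as E'.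
    rewrite sat_iff, (Hp z w Hw) in E'; exact E'. }
  split; intro Hw; apply K; auto; [apply elem_Hered in Hz|];
    eapply Hered_trans; eauto.
Qed.

Lemma push_env a s : a ∈ N -> (forall n, s n ∈ N) -> forall n, push a s n ∈ N.
Proof. intros Ha Hs [|n]; simpl; auto. Qed.

(** Leaves two goals: the set lies in H(theta), and the decoded formula defines it. *)
Ltac elem_compr p s :=
  apply (elem_comprehension p s);
    [ repeat apply push_env; auto | | intros z w Hw; sat_simpl ].

(** * Closure of [N] under definable operations *)

Lemma elem_empty : empty ∈ N.
Proof.
destruct HN as [[a Ha] _].
elem_compr (Fnot (Feq 0 0)) (fun _ : nat => a).
- now apply Hered_empty.
- split; [tauto | intro K; destruct (mem_empty _ K)].
Qed.

Lemma elem_insert a x : a ∈ N -> x ∈ N -> insert a x ∈ N.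
Proof.
intros Ha Hx; elem_compr (For (Fmem 0 3) (Feq 0 2)) (push a (fun _ => x)).
- apply Hered_insert; auto using elem_Hered.
- now rewrite mem_insert.
Qed.

Lemma elem_cup x y : x ∈ N -> y ∈ N -> cup x y ∈ N.
Proof.
intros Hx Hy; elem_compr (For (Fmem 0 2) (Fmem 0 3)) (push x (fun _ => y)).
- apply Hered_cup; auto using elem_Hered.
- now rewrite mem_cup.
Qed.

Lemma elem_inter x y : x ∈ N -> y ∈ N -> x ∩ y ∈ N.
Proof.
intros Hx Hy; elem_compr (Fand (Fmem 0 2) (Fmem 0 3)) (push x (fun _ => y)).
- apply Hered_subset with x; auto using elem_Hered.
  intros z Hz; now apply mem_inter in Hz.
- now rewrite mem_inter.
Qed.

Lemma elem_union x : x ∈ N -> union x ∈ N.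
Proof.
intro Hx; elem_compr (Fex (Fand (Fmem 0 3) (Fmem 1 0))) (fun _ : nat => x).
- apply Hered_union; auto using elem_Hered.
- rewrite mem_union; split; [intros (v & _ & Hv & Hwv); eauto|].
  intros [v [Hv Hwv]]; exists v; repeat split; auto.
  apply Hered_trans with x; auto using elem_Hered.
Qed.

Lemma elem_delete b x : b ∈ N -> x ∈ N -> sep x (fun z => z <> b) ∈ N.
Proof.
intros Hb Hx; elem_compr (Fand (Fmem 0 3) (Fnot (Feq 0 2))) (push b (fun _ => x)).
- apply Hered_subset with x; auto using elem_Hered.
  intros z Hz; now apply mem_sep in Hz.
- now rewrite mem_sep.
Qed.

Lemma elem_set_of l : (forall z, In z l -> z ∈ N) -> set_of l ∈ N.
Proof.
induction l as [|a l IH]; simpl; intro H; [exact elem_empty|].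
apply elem_insert; auto.
Qed.

(* [finsub X] is the least set containing the empty set and closed under adding
   one element of [X]; that description involves no functions. *)
Lemma elem_finsub X : X ∈ N -> finsub X ∈ N.
Proof.
intro HX.
(* The formula puts [w] into every [u] that contains the empty set and, with each [s] in [u] and [a]
   in [X], also the set [r] with the members of [s] and [a]. *)
elem_compr
  (Fall (Fimp
     (Fand
        (Fall (Fimp (Fall (Fnot (Fmem 0 1))) (Fmem 0 1)))
        (Fall (Fimp (Fmem 0 1) (Fall (Fimp (Fmem 0 5)
           (Fall (Fimp (Fall (Fiff (Fmem 0 1) (For (Fmem 0 3) (Feq 0 2))))
              (Fmem 0 3))))))))
     (Fmem 1 0)))
  (fun _ : nat => X).
- apply Hered_finsub; auto using elem_Hered.
- split.
  + intro K; apply K; [apply Hered_finsub; auto using elem_Hered|split].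
    * intros e He E; apply mem_finsub; exists nil; split; [intros _ []|].
      destruct (empty_or_mem e) as [Ee | [v Hv]]; auto.
      destruct (E v); auto; now apply Hered_trans with e.
    * intros s _ Hs a _ Ha r Hr E; apply mem_finsub in Hs as (l & Hl & ->).
      apply mem_finsub; exists (a :: l); split.
      { intros v [<- | Hv]; auto. }
      apply extensionality; intro v; simpl; rewrite mem_insert; split; intro Hv.
      -- apply E; auto; now apply Hered_trans with r.
      -- apply E; auto.
         assert (HHX : Hered theta X) by now apply elem_Hered.
         destruct Hv as [Hv | ->]; [|now apply Hered_trans with X].
         apply mem_set_of in Hv; apply Hered_trans with X; auto.
  + intros Hs u Hu [K0 K1]; apply mem_finsub in Hs as (l & Hl & ->); clear Hw.
    assert (HHX : Hered theta X) by now apply elem_Hered.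
    induction l as [|a l IH]; simpl.
    * apply K0; [now apply Hered_empty|]; intros v _; apply mem_empty.
    * assert (Hl' : forall z, In z l -> z ∈ X) by (intros; apply Hl; now right).
      assert (Ha : a ∈ X) by (apply Hl; now left).
      assert (HHa : Hered theta a) by now apply Hered_trans with X.
      assert (HHl : Hered theta (set_of l)).
      { apply Hered_set_of; auto; intros v Hv; apply Hered_trans with X; auto. }
      apply (K1 (set_of l)) with a; auto; [now apply Hered_insert|].
      intros v _; apply mem_insert.
Qed.

(** By elementarity a nonempty finite set in [N] has a member [b] in [N]. Deleting [b] leaves a set
    in [N] with a shorter list, so induction on the length applies. *)
Lemma elem_finite_subset l : set_of l ∈ N -> set_of l ⊆ N.
Proof.
remember (length l) as n eqn:Hn; revert l Hn.
induction n as [n IH] using lt_wf_ind; intros l -> Hl z Hz.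
destruct (elem_witness (Fmem 0 1) (fun _ => set_of l)) as [b [Hb Hbl]]; auto.
{ exists z; split; auto; apply elem_Hered in Hl; now apply Hered_trans with (set_of l). }
cbn in Hbl; destruct (classic (z = b)) as [-> | Hzb]; auto.
pose (l' := remove (fun x y => excluded_middle_informative (x = y)) b l).
assert (El : set_of l' = sep (set_of l) (fun z => z <> b)).
{ apply extensionality; intro v; rewrite mem_sep, !mem_set_of; split.
  - intro Hv; apply in_remove in Hv; tauto.
  - intros [Hv Hvb]; now apply in_in_remove. }
apply (IH (length l')) with l'; auto.
- apply remove_length_lt; now apply mem_set_of.
- rewrite El; now apply elem_delete.
- rewrite El; now apply mem_sep.
Qed.

(** Being a chain under inclusion is first-order. It holds in [N] by assumption, so it holds in
    H(theta), where inclusion is computed correctly by transitivity. *)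
Lemma elem_chain E :
  E ∈ N ->
  (forall s t, s ∈ N ∩ E -> t ∈ N ∩ E -> s ⊆ t \/ t ⊆ s) ->
  forall s t, s ∈ E -> t ∈ E -> s ⊆ t \/ t ⊆ s.
Proof.
intros HE Hch.
pose (p := Fall (Fimp (Fmem 0 1) (Fall (Fimp (Fmem 0 2)
  (For (Fall (Fimp (Fmem 0 2) (Fmem 0 1))) (Fall (Fimp (Fmem 0 1) (Fmem 0 2)))))))).
assert (K : sat (Hered theta) (fun _ => E) p).
{ apply (proj2 (proj2 HN)); [auto|]; unfold p; sat_simpl.
  intros s Hs HsE t Ht HtE.
  destruct (Hch s t (proj2 (mem_inter N E s) (conj Hs HsE))
              (proj2 (mem_inter N E t) (conj Ht HtE))) as [H | H];
    [left | right]; intros v _; apply H. }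
unfold p in K; revert K; sat_simpl; intros K s t Hs Ht.
assert (HHE : Hered theta E) by now apply elem_Hered.
assert (HHs : Hered theta s) by now apply Hered_trans with E.
assert (HHt : Hered theta t) by now apply Hered_trans with E.
destruct (K s HHs Hs t HHt Ht) as [H | H]; [left | right]; intros v Hv; apply H; auto.
- now apply Hered_trans with s.
- now apply Hered_trans with t.
Qed.

End Elementary.

(** * Initial segments of an enumeration and the guessing property *)

Theorem theorem1p4 (omega1 omega2 theta N : V)
  (Homega1 : successor_cardinal omega omega1)
  (Homega2 : successor_cardinal omega1 omega2)
  (Htheta : regular_cardinal theta)
  (Hle : ord_le omega2 theta)
  (HN : elementary_substructure (fun a => mem a N) (Hered theta))
  (Hsub : subset omega1 N) :
  guessing N -> internally_unbounded N.
Proof.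
intros Hguess x0 Hx0N Hx0c [X0 [HX0 Hx0X]].
assert (Hom1 : omega ∈ omega1) by apply Homega1.
assert (Hom2 : omega ∈ omega2).
{ apply (proj1 (proj1 (proj1 Homega2)) omega1); auto; apply Homega2. }
assert (Homega : omega ∈ theta).
{ destruct Hle as [H | <-]; auto; now apply (proj1 (proj1 (proj1 Htheta)) omega2). }
assert (HomN : omega ∈ N) by auto.
assert (HomsN : omega ⊆ N).
{ intros z Hz; apply Hsub, (proj1 (proj1 (proj1 Homega1)) omega); auto. }
(* Adding [omega] makes the set infinite even if [x0] is finite, as an injective enumeration and a
   countably infinite cover require. *)
pose (x := cup x0 omega); pose (X := cup X0 omega).
assert (HX : X ∈ N) by now apply (elem_cup theta).
assert (HxN : x ⊆ N) by (intros z Hz; apply mem_cup in Hz as [Hz | Hz]; auto).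
assert (HxX : x ⊆ X).
{ intros z Hz; apply mem_cup; apply mem_cup in Hz as [Hz | Hz]; auto. }
assert (Hxinf : infinite x).
{ apply infinite_superset with omega; [|exact infinite_omega].
  intros z Hz; apply mem_cup; auto. }
destruct (enumerate x) as (e & He & Hinj & Hsur); auto.
{ apply enumerable_cup; [now apply enumerable_countable | exact enumerable_omega]. }
pose (ini n := set_of (map e (seq 0 n))).
assert (Hini : forall n z, z ∈ ini n <-> exists i, i < n /\ e i = z).
{ intros n z; unfold ini; rewrite mem_set_of, in_map_iff; split.
  - intros [i [Hi Hin]]; apply in_seq in Hin; exists i; split; [lia | auto].
  - intros [i [Hi <-]]; exists i; split; auto; apply in_seq; lia. }
assert (Hmono : forall m n, m <= n -> ini m ⊆ ini n).
{ intros m n L z Hz; apply Hini in Hz as [i [Hi <-]]; apply Hini; exists i; split; auto; lia. }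
assert (HiniN : forall n, ini n ∈ N).
{ intro n; apply (elem_set_of theta); auto.
  intros z Hz; apply in_map_iff in Hz as [i [<- _]]; auto. }
assert (HiniX : forall n, ini n ∈ finsub X).
{ intro n; apply mem_finsub; eexists; split; [|reflexivity].
  intros z Hz; apply in_map_iff in Hz as [i [<- _]]; auto. }
assert (HFX : finsub X ∈ N) by now apply (elem_finsub theta).
(* Both cases end here, with [union a] as the cover. The members of [a] are finite sets in [N],
   hence subsets of [N]. *)
assert (Hcover : forall a, a ∈ N -> a ⊆ N -> a ⊆ finsub X -> enumerable a ->
          (forall m, exists n, m <= n /\ ini n ∈ a) ->
          exists y, y ∈ N /\ in_Pomega N y /\ x0 ⊆ y).
{ intros a Ha HaN HaX Hae Hcof.
  assert (Hxy : x ⊆ union a).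
  { intros z Hz; destruct (Hsur z Hz) as [i <-], (Hcof (i + 1)) as [n [Hn Hna]].
    apply mem_union; exists (ini n); split; auto; apply Hini; exists i; split; auto; lia. }
  exists (union a); split; [now apply (elem_union theta)|]; split; [split|].
  - intros z Hz; apply mem_union in Hz as [s [Hs Hz]].
    destruct (proj1 (mem_finsub X s) (HaX s Hs)) as (l & _ & ->).
    apply (elem_finite_subset theta) with l; auto.
  - apply equinumerous_omega.
    + apply enumerable_union; auto; intros s Hs.
      destruct (proj1 (mem_finsub X s) (HaX s Hs)) as (l & _ & ->).
      apply enumerable_set_of.
    + now apply infinite_superset with x.
  - intros z Hz; apply Hxy, mem_cup; auto. }
destruct (classic (exists a, a ∈ N /\ in_Pomega N a /\
            forall m, exists n, m <= n /\ ini n ∈ a)) as [(a & Ha & [HaN Hac] & Hcof) | Hno].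
(* The intersection keeps every [ini n] in [a] and discards members that are not finite subsets of
   [X]. *)
- apply (Hcover (a ∩ finsub X)).
  + now apply (elem_inter theta).
  + intros z Hz; apply mem_inter in Hz as [Hz _]; auto.
  + intros z Hz; now apply mem_inter in Hz.
  + apply enumerable_subset with a; [|now apply enumerable_equinumerous].
    intros z Hz; now apply mem_inter in Hz.
  + intro m; destruct (Hcof m) as [n [Hn Hna]]; exists n; split; auto.
    now apply mem_inter.
- pose (c := sep (finsub X) (fun s => exists n, ini n = s)).
  assert (Hc : forall s, s ∈ c <-> exists n, ini n = s).
  { intro s; unfold c; rewrite mem_sep; split; [tauto|].
    intros [n <-]; split; eauto. }
  destruct (Hguess c) as (E & HE & EcE).
  + intros s Hs; apply Hc in Hs as [n <-]; auto.
  + exists (finsub X); split; auto; intros s Hs; now apply mem_sep in Hs.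
  + intros a Ha HaP.
    (* Only finitely many [ini n] lie in [a], so [c ∩ a] is a finite subset of [N] and therefore
       belongs to [N]. *)
    assert (Hm : exists m, forall n, ini n ∈ a -> n < m).
    { apply NNPP; intro K; apply Hno; exists a; do 2 (split; [assumption|]).
      intro m; apply NNPP; intro L; apply K; exists m; intros n Hn.
      apply Nat.nle_gt; intro; apply L; eauto. }
    destruct Hm as [m Hm].
    pose (l := filter (fun s => if excluded_middle_informative (s ∈ a) then true else false)
                 (map ini (seq 0 m))).
    assert (Hl : forall s, In s l <-> (exists i, i < m /\ ini i = s) /\ s ∈ a).
    { intro s; unfold l; rewrite filter_In, in_map_iff.
      destruct (excluded_middle_informative (s ∈ a)) as [K | K].
      - split; intros [[i Hi] _]; (split; [exists i|auto]).
        + destruct Hi as [Hi Hs]; apply in_seq in Hs; split; [lia | auto].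
        + split; [tauto|]; apply in_seq; lia.
      - split; intros [_ L]; [discriminate | contradiction]. }
    replace (c ∩ a) with (set_of l).
    * apply (elem_set_of theta); auto.
      intros s Hs; apply Hl in Hs as [[i [_ <-]] _]; auto.
    * apply extensionality; intro s; rewrite mem_set_of, mem_inter, Hl, Hc.
      split; intros [[i Hi] Hs]; split; auto; exists i; [tauto|].
      split; auto; apply Hm; now rewrite Hi.
  (* The guessed set may have arbitrary members outside [N]; this makes all of them finite. *)
  + pose (E' := E ∩ finsub X).
    assert (HE' : E' ∈ N) by now apply (elem_inter theta).
    assert (HiniE : forall n, ini n ∈ E').
    { intro n; assert (K : ini n ∈ c) by (apply Hc; eauto).
      rewrite EcE in K; apply mem_inter in K as [_ K]; now apply mem_inter. }
    assert (HNE : forall s, s ∈ N -> s ∈ E' -> exists n, ini n = s).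
    { intros s Hs HsE; apply mem_inter in HsE as [HsE _].
      apply Hc; rewrite EcE; now apply mem_inter. }
    assert (Hch : forall s t, s ∈ E' -> t ∈ E' -> s ⊆ t \/ t ⊆ s).
    { apply (elem_chain theta Htheta Homega N HN E' HE').
      intros s t Hs Ht; apply mem_inter in Hs as [Hs HsE], Ht as [Ht HtE].
      destruct (HNE s Hs HsE) as [m <-], (HNE t Ht HtE) as [n <-].
      destruct (le_ge_dec m n); auto. }
    assert (HEN : E' ⊆ N).
    { intros s Hs; pose proof Hs as Hfin; apply mem_inter in Hfin as [_ Hfin].
      apply mem_finsub in Hfin as (l & _ & ->).
      apply (elem_set_of theta); auto; intros z Hz.
      (* Compare [s] with an initial segment having one element more than the list of [s]: by
         pigeonhole [s] is the smaller one, so it is a finite subset of [N]. *)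
      destruct (Hch _ _ Hs (HiniE (S (length l)))) as [K | K].
      - apply mem_set_of, K, Hini in Hz as [i [_ <-]]; auto.
      - exfalso; enough (S (length l) <= length l) by lia.
        apply (incl_length_inj e); auto.
        intros v Hv; apply mem_set_of, K; now apply mem_set_of. }
    (* As [E'] is included in [N], its members are exactly the [ini n]. *)
    apply (Hcover E'); auto.
    * intros s Hs; now apply mem_inter in Hs.
    * exists ini; intros s Hs; auto.
    * intro m; exists m; auto.
Qed.
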